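(* Suppose that $C$ is Klee with respect to the left Bregman distance, i.e., for every $y\in U$ the set $\overleftarrow{Q}_C(y)$ is nonempty and a singleton. Then $C$ is a singleton.
   Context: $\mathbb{R}^J$ is the standard Euclidean space with inner product $\langle\cdot,\cdot\rangle$ and norm $\|\cdot\|$. Standing assumptions: (1) $f\colon\mathbb{R}^J\to\,]-\infty,+\infty]$ is a convex function of Legendre type, i.e., $f$ is proper, lower semicontinuous, convex, essentially smooth (with $U:=\operatorname{int}\operatorname{dom} f\neq\varnothing$, $f$ is differentiable on $U$ and $\|\nabla f(x_n)\|\to+\infty$ whenever $(x_n)$ is a sequence in $U$ converging to a boundary point of $U$) and essentially strictly convex ($f$ is strictly convex on every convex subset of $\operatorname{dom}\partial f$). (2) $f$ is $1$-coercive: $\lim_{\|x\|\to+\infty} f(x)/\|x\|=+\infty$ (equivalently, $\operatorname{dom} f^*=\mathbb{R}^J$). (3) $C$ is a nonempty bounded closed (hence compact) subset of $U$. The Bregman distance is $D(x,y)=f(x)-f(y)-\langle\nabla f(y),x-y\rangle$ if $y\in U$, and $D(x,y)=+\infty$ otherwise. The left Bregman farthest-point map is the set-valued map $\overleftarrow{Q}_C(y)=\operatorname{argmax}_{x\in C}D(x,y)$ (the set of maximizers), $y\in U$. *)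

(* Defs.v *)
(* MathComp-Analysis; R^J is the type 'rV[R]_J of row vectors. *)
From HB Require Import structures.
From mathcomp Require Import all_boot all_order all_algebra.
From mathcomp Require Import all_classical all_reals all_analysis.

Set Implicit Arguments.
Unset Strict Implicit.
Unset Printing Implicit Defensive.

Import Order.TTheory GRing.Theory Num.Theory.
Import numFieldNormedType.Exports.

Local Open Scope classical_set_scope.
Local Open Scope ring_scope.

Section EuclideanSpace.
Context {R : realType} {J : nat}.
Implicit Types x y : 'rV[R]_J.

Definition dotp x y : R := \sum_(i < J) x 0 i * y 0 i.

(* The library norm `|x| on 'rV[R]_J is the sup norm. It induces the same
   topology, the same bounded sets and the same differentiability as enorm, so
   open, closed, bounded_set and differentiable are the library's; wherever the
   value of a norm matters, enorm is used. *)
Definition enorm x : R := Num.sqrt (dotp x x).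

End EuclideanSpace.

Section ExtendedRealFunctions.
Context {R : realType} {J : nat}.
Implicit Types (f : 'rV[R]_J -> \bar R) (A : set 'rV[R]_J).

Definition edom f : set 'rV[R]_J := [set x | (f x < +oo)%E].

Definition int_edom f : set 'rV[R]_J := interior (edom f).

Definition proper_efun f := (forall x, (-oo < f x)%E) /\ edom f !=set0.

(* The weights lie in ]0, 1[, so that for f > -oo neither oo - oo nor 0 * oo
   occurs in the right-hand side. *)
Definition convex_efun f := forall (x y : 'rV[R]_J) (t : R), 0 < t < 1 ->
  (f (t *: x + (1 - t) *: y)%R <= t%:E * f x + (1 - t)%:E * f y)%E.

Definition strictly_convex_on A f := forall (x y : 'rV[R]_J) (t : R),
  A x -> A y -> x != y ->
  0 < t < 1 ->
  (f (t *: x + (1 - t) *: y)%R < t%:E * f x + (1 - t)%:E * f y)%E.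

(* At points where f is finite in a neighbourhood, the real-valued function
   fine \o f coincides locally with f. *)
Definition real_part f : 'rV[R]_J -> R^o := fun x => fine (f x).

Definition gradient f (x : 'rV[R]_J) : 'rV[R]_J :=
  \row_(i < J) ('D_(delta_mx 0 i) (real_part f) x : R).

Definition subdifferential f (x : 'rV[R]_J) : set 'rV[R]_J :=
  [set u | forall y, (f x + (dotp u (y - x)%R)%:E <= f y)%E].

(* For proper f, subdifferential f x is empty as soon as f x = +oo. *)
Definition dom_subdifferential f : set 'rV[R]_J :=
  [set x | subdifferential f x !=set0].

Definition boundary A : set 'rV[R]_J := closure A `\` interior A.

Definition essentially_smooth f :=
  [/\ int_edom f !=set0,
      forall x, int_edom f x -> differentiable (real_part f) x
    & forall (u : nat -> 'rV[R]_J) (x : 'rV[R]_J),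
        (forall n, int_edom f (u n)) -> boundary (int_edom f) x ->
        u n @[n --> \oo] --> x ->
        enorm (gradient f (u n)) @[n --> \oo] --> +oo].

Definition essentially_strictly_convex f :=
  forall A, convex_set A -> A `<=` dom_subdifferential f ->
  strictly_convex_on A f.

Record convex_legendre f : Prop := ConvexLegendre {
  legendre_proper : proper_efun f;
  legendre_lsc : lower_semicontinuous f;
  legendre_convex : convex_efun f;
  legendre_smooth : essentially_smooth f;
  legendre_strict : essentially_strictly_convex f }.

Definition one_coercive f := forall M : R, exists r : R,
  forall x, r < enorm x -> (M%:E < f x * (enorm x)^-1%:E)%E.

Definition bregman f (x y : 'rV[R]_J) : \bar R :=
  if y \in int_edom f
  then (f x - f y - (dotp (gradient f y) (x - y)%R)%:E)%E
  else +oo%E.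

Definition left_farthest f (C : set 'rV[R]_J) (y : 'rV[R]_J) :
    set 'rV[R]_J :=
  [set x | C x /\ forall z, C z -> (bregman f z y <= bregman f x y)%E].

Definition left_klee f (C : set 'rV[R]_J) :=
  forall y, int_edom f y -> exists x, left_farthest f C y = [set x].

End ExtendedRealFunctions.

(* Main.v *)
(* Every u in R^J is the gradient of f at a unique point Y u of U, namely the
   maximizer of <u, y> - f y; uniqueness of the farthest points means that
   f x - <u, x> has a unique maximizer X u on C. The sum F u of these two maxima
   is convex, coercive and has Y u - X u as a subgradient, so it has a minimizer
   u0. Both Y and X are continuous at u0, hence F is differentiable there and
   Y u0 = X u0 is a point y of C. As D(x, y) <= D(y, y) = 0 for every x in C,
   strict convexity yields C = {y}. *)
Require Import Defs.
From mathcomp Require Import all_boot all_order all_algebra.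
From mathcomp Require Import all_classical all_reals all_analysis.
From mathcomp Require Import ring lra.

Set Implicit Arguments.
Unset Strict Implicit.
Unset Printing Implicit Defensive.

Import Order.TTheory GRing.Theory Num.Theory.
Import numFieldNormedType.Exports.

Local Open Scope classical_set_scope.
Local Open Scope ring_scope.

(** * Dot product, sup norm and Euclidean norm *)

Section DotProduct.
Context {R : realType} {J : nat}.
Implicit Types x y z : 'rV[R]_J.

Lemma dotpC x y : dotp x y = dotp y x.
Proof. by apply: eq_bigr => i _; rewrite mulrC. Qed.

Lemma dotpDr x y z : dotp x (y + z) = dotp x y + dotp x z.
Proof. by rewrite -big_split; apply: eq_bigr => i _; rewrite mxE mulrDr. Qed.

Lemma dotpZr (a : R) x y : dotp x (a *: y) = a * dotp x y.
Proof. by rewrite mulr_sumr; apply: eq_bigr => i _; rewrite mxE mulrCA. Qed.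

Lemma dotpNr x y : dotp x (- y) = - dotp x y.
Proof. by rewrite -scaleN1r dotpZr mulN1r. Qed.

Lemma dotpBr x y z : dotp x (y - z) = dotp x y - dotp x z.
Proof. by rewrite dotpDr dotpNr. Qed.

Lemma dotpBl x y z : dotp (x - y) z = dotp x z - dotp y z.
Proof. by rewrite dotpC dotpBr !(dotpC z). Qed.

Lemma dotp_ge0 x : 0 <= dotp x x.
Proof. by apply: sumr_ge0 => i _; rewrite -expr2 sqr_ge0. Qed.

Lemma dotp_gt0 x : x != 0 -> 0 < dotp x x.
Proof.
apply: contraNT; rewrite lt0r dotp_ge0 andbT negbK psumr_eq0; last first.
  by move=> i _; rewrite -expr2 sqr_ge0.
move=> /allP x0; apply/eqP/rowP => i; rewrite mxE.
by have := x0 i; rewrite mem_index_enum -expr2 sqrf_eq0 => /(_ isT)/eqP.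
Qed.

Lemma ler_coord_mx_norm x i : `|x 0 i| <= `|x|.
Proof.
rewrite [leRHS]/Num.norm /= mx_normrE.
by apply/bigmax_geP; right; exists (0, i).
Qed.

(** A coordinatewise bound in the sup norm replaces Cauchy-Schwarz; the factor J only affects moduli
    of continuity and growth constants. *)
Lemma ler_norm_dotp x y : `|dotp x y| <= J%:R * (`|x| * `|y|).
Proof.
apply: le_trans (ler_norm_sum _ _ _) _.
rewrite mulr_natl -[X in _ *+ X]card_ord -sumr_const; apply: ler_sum => i _.
by rewrite normrM ler_pM ?normr_ge0 ?ler_coord_mx_norm.
Qed.

Lemma enorm_ge0 x : 0 <= enorm x.
Proof. exact: sqrtr_ge0. Qed.

Lemma sqr_enorm x : enorm x ^+ 2 = dotp x x.
Proof. by rewrite sqr_sqrtr ?dotp_ge0. Qed.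

Lemma ler_norm_enorm x : `|x| <= enorm x.
Proof.
rewrite [leLHS]/Num.norm /= mx_normrE; apply/bigmax_leP; split=> [|[i j] _ /=].
  exact: enorm_ge0.
rewrite -(ler_sqr (normr_ge0 _) (enorm_ge0 _)) sqr_enorm.
rewrite (ord1 i) real_normK ?num_real // /dotp (bigD1 j) //= -expr2 lerDl.
by apply: sumr_ge0 => k _; rewrite -expr2 sqr_ge0.
Qed.

Lemma continuous_dotpr (u : 'rV[R]_J) : continuous (dotp u).
Proof.
apply: continuous_big => [|i _ x]; first exact: add_continuous.
apply: (@continuousM R 'rV[R]_J (fun=> u 0 i) (fun y => y 0 i)).
  exact: cst_continuous.
exact: coord_continuous.
Qed.

End DotProduct.

(** * Existence of minimizers of lower semicontinuous functions *)

Section LowerSemicontinuousMinimum.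
Local Open Scope ereal_scope.

Lemma lt_ereal_fin_between {R : realType} (a b : \bar R) :
  a < b -> exists2 r : R, a < r%:E & r%:E < b.
Proof.
case: a b => [a| |] [b| |] //.
- rewrite lte_fin => ab; exists ((a + b) / 2)%R; rewrite lte_fin; lra.
- by move=> _; exists (a + 1)%R; rewrite ?ltry // lte_fin; lra.
- by move=> _; exists (b - 1)%R; rewrite ?ltNyr // lte_fin; lra.
- by move=> _; exists 0%R; rewrite ?ltry ?ltNyr.
Qed.

Lemma lsc_compact_min {R : realType} {T : topologicalType} (K : set T)
    (h : T -> \bar R) :
  lower_semicontinuous h -> compact K -> K !=set0 ->
  exists2 x, K x & forall y, K y -> h x <= h y.
Proof.
move=> hlsc /compact_near_coveringP Kc [x0 Kx0]; apply: contrapT => nomin.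
pose m := ereal_inf [set h x | x in K].
have mh x : K x -> m < h x.
  move=> Kx; rewrite lt_neqAle; apply/andP; split; last first.
    by apply: ereal_inf_lbound; exists x.
  apply/eqP => mx; apply: nomin; exists x => // y Ky.
  by rewrite -mx; apply: ereal_inf_lbound; exists y.
(* A property holds eventually along [F] if it holds for all s below some real r > m; this makes
   sense for m = -oo too. If m is not attained, compactness turns the local bounds s < h into one r
   > m below h on all of K. *)
pose F :=
  filter_from [set r : R | m < r%:E] (fun r => [set s : R | (s <= r)%R]).
have FF : Filter F.
  apply: filter_from_filter => [|r s mr ms].
    by have [r] := lt_ereal_fin_between (mh _ Kx0); exists r.
  exists (Num.min r s); first by rewrite /= minEle; case: ifP.
  by move=> t /=; rewrite le_min => /andP.
have [x Kx|r /= mr rK] := Kc R F (fun r x => r%:E < h x) FF.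
  have [r mr /hlsc[V Vx rV]] := lt_ereal_fin_between (mh _ Kx).
  exists (V, [set s : R | (s <= r)%R]); first by split=> //; exists r.
  by move=> [y s] [/= /rV + sr]; apply: le_lt_trans; rewrite lee_fin.
suff : r%:E <= m by rewrite leNgt mr.
by apply: le_ereal_inf_tmp => _ [x Kx <-]; apply/ltW/rK => /=.
Qed.

(** A minimizer on the closed ball of radius max(r, |x0|) is global, because this ball contains x0
    and h is at least h x0 outside it. *)
Lemma lsc_coercive_min {R : realType} {n : nat} (h : 'rV[R]_n -> \bar R)
    (x0 : 'rV[R]_n) (r : R) :
  lower_semicontinuous h -> (forall x, (r < `|x|)%R -> h x0 <= h x) ->
  exists x, forall y, h x <= h y.
Proof.
move=> hlsc hr; pose K := [set x : 'rV[R]_n | `|x| <= Num.max r `|x0|]%R.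
have Kc : compact K.
  apply: bounded_closed_compact.
    exists (Num.max r `|x0|)%R; split; first exact: num_real.
    by move=> s /ltW rs x /= /le_trans; exact.
  apply: (@closed_comp _ _ (fun x : 'rV[R]_n => `|x|)%R
    [set s | s <= Num.max r `|x0|]%R).
    by move=> x _; exact: norm_continuous.
  exact: closed_le.
have Kx0 : K x0 by rewrite /K /= le_max lexx orbT.
have [|x Kx hx] := lsc_compact_min hlsc Kc; first by exists x0.
exists x => y; have [/hx//|Ky] := pselect (K y).
apply: (le_trans (hx _ Kx0)); apply: hr; rewrite ltNge; apply/negP => yr.
by apply: Ky; rewrite /K /= le_max yr.
Qed.

End LowerSemicontinuousMinimum.

(** * One-sided bounds on directional derivatives *)

Section DirectionalDerivative.
Context {R : realType} {V : normedModType R} (g : V -> R^o) (y h : V) (c : R).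
Hypothesis dg : derivable g y h.

Let quotient_cvg :
  t^-1 *: (g (t *: h + y) - g y) @[t --> 0^'+] --> ('D_h g y : R^o).
Proof. by apply: cvg_dnbhs_at_right; exact: dg. Qed.

Lemma derive_le_right :
  (\forall t \near 0^'+, g (t *: h + y) - g y <= t * c) -> 'D_h g y <= c.
Proof.
move=> gc; apply: (cvgr_to_le quotient_cvg); near=> t.
have t0 : 0 < t by near: t; exact: nbhs_right_gt.
by rewrite /GRing.scale /= ler_pdivrMl //; near: t.
Unshelve. all: by end_near. Qed.

Lemma derive_ge_right :
  (\forall t \near 0^'+, t * c <= g (t *: h + y) - g y) -> c <= 'D_h g y.
Proof.
move=> gc; apply: (cvgr_to_ge quotient_cvg); near=> t.
have t0 : 0 < t by near: t; exact: nbhs_right_gt.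
by rewrite /GRing.scale /= ler_pdivlMl //; near: t.
Unshelve. all: by end_near. Qed.

End DirectionalDerivative.

(** * Convex functions, their gradients and subgradients *)

Section ConvexFunction.
Context {R : realType} {J : nat} (f : 'rV[R]_J -> \bar R).
Implicit Types x y z u : 'rV[R]_J.

Lemma int_edom_sub : int_edom f `<=` edom f.
Proof. exact: interior_subset. Qed.

Lemma derive_gradient y h : differentiable (real_part f) y ->
  'D_h (real_part f) y = dotp (gradient f y) h.
Proof.
move=> df; rewrite deriveE // {1}(row_sum_delta h) linear_sum /=.
apply: eq_bigr => i _.
by rewrite linearZ /= mxE deriveE // mulrC.
Qed.

Hypothesis f_proper : proper_efun f.

Lemma edom_fineK x : edom f x -> (fine (f x))%:E = f x.
Proof.
move=> fx; rewrite fineK // fin_numElt; apply/andP; split=> //.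
exact: f_proper.1.
Qed.

Lemma edom_fin x r : (f x <= r%:E)%E -> edom f x.
Proof. by move=> /le_lt_trans; apply; rewrite ltry. Qed.

Hypothesis f_convex : convex_efun f.

Lemma convex_fine x y t : edom f x -> edom f y -> 0 < t < 1 ->
  (f (t *: x + (1 - t) *: y)%R <=
    (t * fine (f x) + (1 - t) * fine (f y))%:E)%E.
Proof.
move=> fx fy t01; apply: (le_trans (f_convex x y t01)).
by rewrite -(edom_fineK fx) -(edom_fineK fy).
Qed.

Lemma convex_fine_le x y t : edom f x -> edom f y -> 0 < t < 1 ->
  fine (f (t *: x + (1 - t) *: y)) <= t * fine (f x) + (1 - t) * fine (f y).
Proof.
move=> fx fy t01; have := convex_fine fx fy t01.
by move=> /[dup]/edom_fin/edom_fineK <-; rewrite lee_fin.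
Qed.

(** The homothety of centre y and ratio t maps a ball around x inside dom f onto a ball around the
    new point, and convexity keeps the image in dom f. In the proof, x' is the preimage of w. *)
Lemma int_edom_segment x y t : int_edom f x -> edom f y -> 0 < t <= 1 ->
  int_edom f (t *: x + (1 - t) *: y).
Proof.
move=> fx fy /andP[t0]; rewrite le_eqVlt => /predU1P[->|t1].
  by rewrite subrr scale0r addr0 scale1r.
move: fx => /nbhs_ballP[e /= e0 fe]; apply/nbhs_ballP.
exists (t * e) => /=; first exact: mulr_gt0.
move=> w; rewrite -ball_normE /= => wB.
pose x' := t^-1 *: (w - (1 - t) *: y).
have x'E : w = t *: x' + (1 - t) *: y.
  by rewrite /x' scalerA divff ?gt_eqF // scale1r subrK.
have fx' : edom f x'.
  apply: fe; rewrite -ball_normE /=.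
  rewrite -(ltr_pM2l t0); apply: le_lt_trans wB.
  rewrite -[t in t * _]gtr0_norm // -normrZ x'E scalerBr.
  by rewrite opprD addrACA subrr addr0.
rewrite x'E; apply: edom_fin; apply: convex_fine => //; exact/andP.
Qed.

Lemma convex_int_edom : convex_set (int_edom f).
Proof.
apply/convex_setW => x y /set_mem fx /set_mem fy t t0 t1; apply/mem_set.
apply: int_edom_segment => //; first exact: int_edom_sub.
by rewrite t0 ltW.
Qed.

(** By convexity the difference quotients at y in the direction x - y are at most f x - f y. *)
Lemma gradient_ineq y x : differentiable (real_part f) y ->
  edom f y -> edom f x ->
  fine (f y) + dotp (gradient f y) (x - y) <= fine (f x).
Proof.
move=> df fy fx; rewrite -lerBrDl -derive_gradient //.
apply: derive_le_right; first exact: diff_derivable.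
near=> t.
have t01 : 0 < t < 1.
  by apply/andP; split; near: t; [exact: nbhs_right_gt|exact: nbhs_right_lt].
have := convex_fine_le fx fy t01; rewrite /real_part.
have -> : t *: (x - y) + y = t *: x + (1 - t) *: y.
  by apply/rowP => i; rewrite !mxE; ring.
by lra.
Unshelve. all: by end_near. Qed.

(** The difference quotients at y in a direction h are at least <u, h>, so <u - gradient f y, h> <=
    0; the choice h = u - gradient f y forces equality. *)
Lemma subgradient_unique y u : differentiable (real_part f) y ->
  (forall x, int_edom f x -> fine (f y) + dotp u (x - y) <= fine (f x)) ->
  int_edom f y -> u = gradient f y.
Proof.
move=> df fu fy.
have duh h : dotp u h <= dotp (gradient f y) h.
  rewrite -derive_gradient //; apply: derive_ge_right.
    exact: diff_derivable.
  have yh : t *: h + y @[t --> (0 : R)] --> 0 *: h + y.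
    by apply: cvgD; [apply: cvgZr_tmp; exact: cvg_id|exact: cvg_cst].
  rewrite scale0r add0r in yh.
  have fyh : \forall t \near 0^'+, int_edom f (t *: h + y).
    exact: cvg_at_right_filter yh _ (nbhs_interior fy).
  near=> t; have /fu : int_edom f (t *: h + y) by near: t.
  by rewrite addrK dotpZr /real_part lerBrDl.
apply/eqP; rewrite -subr_eq0; apply/negPn/negP => /dotp_gt0.
by apply/negP; rewrite -leNgt dotpBl subr_le0.
Unshelve. all: by end_near. Qed.

End ConvexFunction.

(** * Continuity of translations and distances, and semicontinuous differences *)

Lemma continuous_subr {R : realType} {n : nat} (y : 'rV[R]_n) :
  continuous (fun x : 'rV[R]_n => x - y).
Proof.
move=> x; apply: (@continuousB R 'rV[R]_n 'rV[R]_n id (cst y)).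
  by move=> ?; exact.
exact: cst_continuous.
Qed.

Lemma continuous_dist {R : realType} {n : nat} (y : 'rV[R]_n) :
  continuous (fun x : 'rV[R]_n => `|x - y|).
Proof.
move=> x.
exact: (continuous_comp (@continuous_subr R n y x)
  (@norm_continuous R 'rV[R]_n (x - y))).
Qed.

Lemma lsc_sub_continuous {R : realType} {T : topologicalType}
    (f : T -> \bar R) (g : T -> R) :
  lower_semicontinuous f -> continuous g ->
  lower_semicontinuous (fun x => (f x - (g x)%:E)%E).
Proof.
move=> flsc gc x a; rewrite lteBrDr // -EFinD => /lt_ereal_fin_between[r].
rewrite lte_fin -ltrBrDl => gr /flsc[V xV Vr].
exists (V `&` [set y | g y < r - a]).
  apply: filterI => //; exact: (cvgr_lt (g x) (gc x) _ gr).
move=> y [/Vr + gy]; rewrite lteBrDr // -EFinD; apply: le_lt_trans.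
by rewrite lee_fin -lerBrDl; exact: ltW gy.
Qed.

(** * Legendre functions: the gradient as a homeomorphism from U to R^J *)

Section Legendre.
Context {R : realType} {J : nat} (f : 'rV[R]_J -> \bar R).
Hypothesis f_legendre : convex_legendre f.
Implicit Types x y z u : 'rV[R]_J.

Let f_proper := legendre_proper f_legendre.
Let f_convex := legendre_convex f_legendre.

Let f_differentiable y : int_edom f y -> differentiable (real_part f) y.
Proof. by case: (legendre_smooth f_legendre) => _ + _; exact. Qed.

Lemma legendre_continuous y : int_edom f y -> {for y, continuous (real_part f)}.
Proof. by move=> /f_differentiable/differentiable_continuous. Qed.

Lemma legendre_gradient_ineq y x : int_edom f y -> edom f x ->
  fine (f y) + dotp (gradient f y) (x - y) <= fine (f x).
Proof.
move=> fy fx; apply: gradient_ineq => //; first exact: f_differentiable.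
exact: int_edom_sub.
Qed.

(** This makes essential strict convexity applicable on the convex set U. *)
Lemma int_edom_sub_dom_subdifferential :
  int_edom f `<=` dom_subdifferential f.
Proof.
move=> y fy; exists (gradient f y) => x.
have [fx|/negP] := boolP (f x < +oo)%E; last first.
  by rewrite ltey => /negP/negPn/eqP ->; rewrite leey.
rewrite -(edom_fineK f_proper (int_edom_sub fy)) -(edom_fineK f_proper fx).
by rewrite lee_fin legendre_gradient_ineq.
Qed.

(** At the midpoint of x and y, strict convexity gives a strict upper bound on f and the gradient
    inequality a lower one; comparing them gives the claim. *)
Lemma legendre_gradient_ineq_strict y x :
  int_edom f y -> int_edom f x -> x != y ->
  fine (f y) + dotp (gradient f y) (x - y) < fine (f x).
Proof.
move=> fy fx xy.
have h01 : 0 < (2^-1 : R) < 1 by lra.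
have fy' := int_edom_sub fy; have fx' := int_edom_sub fx.
have fxy : edom f (2^-1 *: x + (1 - 2^-1) *: y).
  exact/(edom_fin (convex_fine f_proper f_convex fx' fy' h01)).
have := legendre_strict f_legendre (convex_int_edom f_proper f_convex)
  int_edom_sub_dom_subdifferential fx fy xy h01.
rewrite -(edom_fineK f_proper fy') -(edom_fineK f_proper fx').
rewrite -(edom_fineK f_proper fxy) -!EFinM -EFinD lte_fin.
have := legendre_gradient_ineq fy fxy.
have -> : 2^-1 *: x + (1 - 2^-1) *: y - y = 2^-1 *: (x - y).
  by apply/rowP => i; rewrite !mxE; ring.
rewrite dotpZr; lra.
Qed.

(* On a ball around x where f <= M, the point z farthest in the direction g
   turns an upper bound on <g, z - x> into one on the norm of g. *)
Lemma legendre_bounded_above x : int_edom f x ->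
  exists e M : R, 0 < e /\ forall g, exists z,
    [/\ edom f z, fine (f z) <= M & e * (enorm g - 1) <= dotp g (z - x)].
Proof.
move=> fx.
have /nbhs_ballP[e /= e0 eM] : \forall z \near x,
    edom f z /\ fine (f z) <= fine (f x) + 1.
  apply: filterI => //; apply: (cvgr_le (fine (f x)) (legendre_continuous fx)).
  by rewrite ltrDl.
exists e, (fine (f x) + 1); split=> // g.
have g0 := enorm_ge0 g; have g1 : 0 < 1 + enorm g by lra.
(* Dividing by 1 + enorm g covers g = 0 and keeps z in the open ball. The lower bound comes from s^2
   / (1 + s) >= s - 1 with s = enorm g. *)
pose z := x + (e / (1 + enorm g)) *: g.
have [|fz zM] := eM z.
  rewrite -ball_normE /= /z opprD addrA subrr sub0r normrN normrZ.
  rewrite ger0_norm ?divr_ge0 // ?ltW // -mulrA gtr_pMr //.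
  rewrite mulrC ltr_pdivrMr // mul1r; have := ler_norm_enorm g; lra.
exists z; split=> //; rewrite /z [x + _]addrC addrK dotpZr -sqr_enorm.
rewrite -mulrA ler_pM2l // mulrC ler_pdivlMr //; nra.
Qed.

(* If y were on the boundary of U, the gradients along a segment from y to a
   point of U would stay bounded, against essential smoothness. *)
Lemma subgradient_int_edom y u : edom f y ->
  (forall x, int_edom f x -> fine (f y) + dotp u (x - y) <= fine (f x)) ->
  int_edom f y.
Proof.
move=> fy fu; apply: contrapT => nfy.
have [[x fx] _ f_blowup] := legendre_smooth f_legendre.
have [e [M [e0 eM]]] := legendre_bounded_above fx.
pose y_ n := harmonic n *: x + (1 - harmonic n) *: y.
have s01 n : 0 < (harmonic n : R) <= 1.
  by rewrite harmonic_gt0 /= /harmonic /= invf_le1 // ler1n.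
have fy_ n : int_edom f (y_ n) by exact: int_edom_segment.
have y_y : y_ n @[n --> \oo] --> y.
  have y0 : y = 0 *: x + (1 - 0) *: y by rewrite scale0r add0r subr0 scale1r.
  rewrite [X in _ --> X]y0.
  apply: cvgD; apply: cvgZr_tmp; first exact: cvg_harmonic.
  by apply: cvgB; [exact: cvg_cst|exact: cvg_harmonic].
have by_ : boundary (int_edom f) y.
  split=> [B /y_y[N _ NB]|/interior_subset//].
  exists (y_ N); split; first exact: fy_.
  exact: NB (leqnn N).
pose k := dotp u (x - y).
have grad_le n :
    e * (enorm (gradient f (y_ n)) - 1) <= M - fine (f y) + `|k| + `|k|.
  have /andP[s0 s1] := s01 n; set s := harmonic n in s0 s1 *.
  set g := gradient f (y_ n).
  have [z [fz zM egz]] := eM g.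
  have gz := legendre_gradient_ineq (fy_ n) fz.
  have gy := legendre_gradient_ineq (fy_ n) fy.
  have uy := fu _ (fy_ n).
  move: gz gy uy; rewrite -/g.
  have -> : z - y_ n = (z - x) + (1 - s) *: (x - y).
    by apply/rowP => i; rewrite /y_ -/s !mxE; ring.
  have -> : y - y_ n = (- s) *: (x - y).
    by apply/rowP => i; rewrite /y_ -/s !mxE; ring.
  have -> : y_ n - y = s *: (x - y).
    by apply/rowP => i; rewrite /y_ -/s !mxE; ring.
  rewrite dotpDr !dotpZr -/k => gz gy uy.
  (* Monotonicity: add the gradient inequality at [y_ n] and the subgradient inequality at y. The
     gradient inequality at z then yields <g, z - x> <= M - f y - k, a bound free of n. *)
  have kg : k <= dotp g (x - y) by rewrite -(ler_pM2l s0); lra.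
  have k1 := ler_norm k; have k2 := ler_norm (- k); rewrite normrN in k2.
  have : 0 <= (1 - s) * (dotp g (x - y) - k) by apply: mulr_ge0; lra.
  have : 0 <= (1 - s) * (k + `|k|) by apply: mulr_ge0; lra.
  have : 0 <= s * (k + `|k|) by apply: mulr_ge0; lra.
  nra.
pose G := (M - fine (f y) + `|k| + `|k|) / e + 1.
have /cvgryPgt/(_ G)[N _ /(_ N (leqnn N))] := f_blowup _ _ fy_ by_ y_y.
rewrite /= ltNge => /negP; apply.
by rewrite -lerBlDr ler_pdivlMr // mulrC.
Qed.

(** A minimizer of f - <u, .> exists by coercivity and has u as a subgradient; hence it lies in U
    and its gradient is u. *)
Lemma legendre_gradient_surj u : one_coercive f ->
  exists2 y, int_edom f y & gradient f y = u.
Proof.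
move=> f_coercive.
have [[x0 fx0] _ _] := legendre_smooth f_legendre.
have fx0' := int_edom_sub fx0.
pose h x := (f x - (dotp u x)%:E)%E.
have hlsc : lower_semicontinuous h.
  apply: lsc_sub_continuous; first exact: legendre_lsc f_legendre.
  exact: continuous_dotpr.
pose c := fine (f x0) - dotp u x0.
have hx0 : h x0 = c%:E by rewrite /h -(edom_fineK f_proper fx0') -EFinB.
(* The slope J |u| dominates <u, x>; the extra |c| leaves h x >= |c| enorm x >= c once enorm x > 1,
   whence the radius max(r, 1) below. *)
have [r rM] := f_coercive (J%:R * `|u| + `|c|).
have [x xr|y hy] := @lsc_coercive_min _ _ h x0 (Num.max r 1) hlsc.
  move: xr; rewrite gt_max => /andP[rx x1].
  have ex := ler_norm_enorm x; have ex1 : 1 < enorm x := lt_le_trans x1 ex.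
  have := rM x (lt_le_trans rx ex); rewrite hx0 /h.
  have [fx|/negP] := boolP (f x < +oo)%E; last first.
    by rewrite ltey => /negP/negPn/eqP ->; rewrite leey.
  rewrite -(edom_fineK f_proper fx) -EFinM -EFinB lte_fin lee_fin.
  rewrite ltr_pdivlMr; last lra.
  have := ler_norm c; have := ler_norm (dotp u x); have := ler_norm_dotp u x.
  have : 0 <= J%:R * `|u| * (enorm x - `|x|).
    by rewrite !mulr_ge0 // subr_ge0.
  have : 0 <= `|c| * (enorm x - 1) by rewrite mulr_ge0 // subr_ge0 ltW.
  lra.
have fy : edom f y.
  have := hy x0; rewrite hx0 /h /edom /=.
  by case: (f y) => [s| |] //= _; rewrite ltry.
have fu x : int_edom f x -> fine (f y) + dotp u (x - y) <= fine (f x).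
  move=> /int_edom_sub fx; have := hy x.
  rewrite /h -(edom_fineK f_proper fx) -(edom_fineK f_proper fy) -!EFinB.
  rewrite lee_fin dotpBr; lra.
have fy' := subgradient_int_edom fy fu.
exists y => //; apply/esym/subgradient_unique => //; exact: f_differentiable.
Qed.

(** Used for the continuity of the inverse gradient [Y] in the theorem, without recourse to
    differentiability of the conjugate. *)
Lemma legendre_gradient_inverse_continuous y0 e : int_edom f y0 -> 0 < e ->
  exists2 d : R, 0 < d & forall y, int_edom f y ->
    `|gradient f y - gradient f y0| < d -> `|y - y0| < e.
Proof.
move=> fy0 e0; have /nbhs_ballP[r' /= r'0 r'f] := nbhs_interior fy0.
pose r := Num.min e (r' / 2).
have r0 : 0 < r by rewrite lt_min e0 divr_gt0.
have re : r <= e by rewrite ge_min lexx.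
have rf x : `|x - y0| = r -> int_edom f x.
  move=> xr; apply: r'f; rewrite -ball_normE /= distrC xr /r gt_min.
  by apply/orP; right; lra.
pose S := [set x : 'rV[R]_J | `|x - y0| = r].
have radial y : r <= `|y - y0| -> S (y0 + (r / `|y - y0|) *: (y - y0)).
  move=> ry; rewrite /S /= addrC addKr normrZ ger0_norm ?divr_ge0 // ?ltW //.
  by rewrite divfK // gt_eqF // (lt_le_trans r0).
(* The sphere is empty when J = 0. Then no y lies at distance e or more from y0, as it would project
   radially into S, and any d works. *)
have [S0|S0] := pselect (S !=set0); last first.
  exists 1 => // y _ _; rewrite ltNge; apply/negP => ey.
  by apply: S0; eexists; apply: radial; exact: le_trans re ey.
have Sc : compact S.
  apply: bounded_closed_compact.
    exists (`|y0| + r); split; first exact: num_real.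
    move=> s rs x /= xr; apply: le_trans (ltW rs).
    by rewrite -xr -[in leLHS](subrK y0 x) addrC; exact: ler_normD.
  apply: (@closed_comp _ _ (fun x : 'rV[R]_J => `|x - y0|) [set r]).
    by move=> x _; exact: continuous_dist.
  exact: closed_eq.
(* D = D(., y0) is convex and has a minimum m > 0 on the sphere S, so it grows
   at least like (m / r) |y - y0| outside S; yet it is bounded by
   <gradient f y - g0, y - y0>. *)
pose g0 := gradient f y0.
pose D x := fine (f x) - fine (f y0) - dotp g0 (x - y0).
have [x1 /set_mem Sx1 Dx1] :
    exists2 x1, x1 \in S & forall x, x \in S -> D x1 <= D x.
  apply: compact_EVT_min => //; apply: continuous_in_subspaceT => x /set_mem Sx.
  apply: (@continuousB R R^o 'rV[R]_J (fun z => fine (f z) - fine (f y0))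
    (fun z => dotp g0 (z - y0))).
    apply: (@continuousB R R^o 'rV[R]_J (fine \o f) (cst (fine (f y0)))).
      exact: legendre_continuous (rf _ Sx).
    exact: cst_continuous.
  exact: (continuous_comp (@continuous_subr R J y0 x)
    (@continuous_dotpr R J g0 (x - y0))).
have m0 : 0 < D x1.
  have := legendre_gradient_ineq_strict fy0 (rf _ Sx1).
  rewrite -/g0 /D => /(_ _).
  have -> : x1 != y0; last by move=> /(_ isT); lra.
  by apply: contra_eqN Sx1 => /eqP ->; rewrite subrr normr0 eq_sym gt_eqF.
have J1 : 0 < J%:R + 1 :> R by rewrite ltr_wpDl.
(* If |y - y0| >= r, comparing (m / r) |y - y0| with J |gradient f y - g0| |y - y0| contradicts this
   threshold; J + 1 in place of J avoids a zero divisor. *)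
exists (D x1 / r / (J%:R + 1)) => [|y fy]; first by rewrite !divr_gt0.
rewrite ltr_pdivlMr // => gd; apply: lt_le_trans re; rewrite ltNge.
apply/negP => ry.
have yy0 : 0 < `|y - y0| := lt_le_trans r0 ry.
have t0 : 0 < r / `|y - y0| by rewrite divr_gt0.
have t1 : r / `|y - y0| <= 1 by rewrite ler_pdivrMr // mul1r.
set t := r / `|y - y0| in t0 t1.
have Dt : D x1 <= t * D y.
  apply: (le_trans (Dx1 _ (mem_set (radial _ ry)))); rewrite -/t /D.
  have -> : y0 + t *: (y - y0) - y0 = t *: (y - y0) by rewrite addrC addKr.
  rewrite dotpZr.
  move: t1; rewrite le_eqVlt => /predU1P[->|t1].
    by rewrite !mul1r scale1r [y0 + _]addrC subrK.
  have := convex_fine_le f_proper f_convex (int_edom_sub fy) (int_edom_sub fy0)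
    (introT andP (conj t0 t1)).
  have -> : t *: y + (1 - t) *: y0 = y0 + t *: (y - y0).
    by apply/rowP => i; rewrite !mxE; ring.
  lra.
have Dy : D y <= J%:R * (`|gradient f y - g0| * `|y - y0|).
  apply: le_trans (ler_norm_dotp _ _); apply: le_trans (ler_norm _).
  have := legendre_gradient_ineq fy (int_edom_sub fy0).
  by rewrite /D dotpBl !dotpBr; lra.
have : D x1 / r * `|y - y0| <= D y.
  rewrite mulrAC ler_pdivrMr //; have := ler_wpM2r (ltW yy0) Dt.
  by rewrite [t * _ * _]mulrAC divfK ?gt_eqF // [r * _]mulrC.
move: gd; rewrite -(ltr_pM2r yy0); have := normr_ge0 (gradient f y - g0).
rewrite -/g0; nra.
Qed.

End Legendre.

(** * Farthest points as maximizers of f - <u, .> on C *)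

(** By compactness, points of C at distance at least e from x0 miss the maximal value by a fixed
    gap. Passing from u0 to u changes the comparison of x with x0 only by <u - u0, x - x0>, which is
    below the gap for u near u0. *)
Lemma unique_argmax_continuous {R : realType} {J : nat} (C : set 'rV[R]_J)
    (phi : 'rV[R]_J -> R) (u0 x0 : 'rV[R]_J) (e : R) :
  bounded_set C -> closed C -> {in C, continuous phi} -> C x0 ->
  (forall x, C x -> x != x0 -> phi x - dotp u0 x < phi x0 - dotp u0 x0) ->
  0 < e ->
  exists2 d : R, 0 < d & forall u x, `|u - u0| < d -> C x ->
    (forall z, C z -> phi z - dotp u z <= phi x - dotp u x) -> `|x - x0| < e.
Proof.
move=> Cb Ccl phic Cx0 x0_max e0.
pose K := C `&` [set x | e <= `|x - x0|].
have Kc : compact K.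
  apply: compact_closedI; first exact: bounded_closed_compact.
  apply: (@closed_comp _ _ (fun x : 'rV[R]_J => `|x - x0|) [set r | e <= r]).
    by move=> x _; exact: continuous_dist.
  exact: closed_ge.
have [K0|K0] := pselect (K !=set0); last first.
  exists 1 => // u x _ Cx _; rewrite ltNge; apply/negP => ex.
  by apply: K0; exists x.
pose psi x := phi x - dotp u0 x.
have [x1 /set_mem[Cx1 ex1] psix1] :
    exists2 x1, x1 \in K & forall x, x \in K -> psi x <= psi x1.
  apply: compact_EVT_max => //; apply: continuous_in_subspaceT.
  move=> x /set_mem[Cx _].
  apply: (@continuousB R R^o 'rV[R]_J phi (dotp u0)).
    exact/phic/mem_set.
  exact: continuous_dotpr.
have m0 : 0 < psi x0 - psi x1.
  rewrite subr_gt0; apply: x0_max => //; apply: contraTneq ex1 => ->.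
  by rewrite /= subrr normr0 -ltNge.
have [B [_ CB]] := Cb.
(* [bounded_set] bounds C only by reals strictly above B. *)
pose b := `|B| + 1; have b0 : 0 < b by rewrite ltr_wpDl.
have Cb' x : C x -> `|x| <= b.
  move=> Cx; apply: (CB b) => //.
  by rewrite (le_lt_trans (ler_norm B)) // ltrDl.
have k0 : 0 < J%:R * (b + b) + 1.
  by rewrite ltr_wpDl // mulr_ge0 // ltW // addr_gt0.
exists ((psi x0 - psi x1) / (J%:R * (b + b) + 1)) => [|u x].
  exact: divr_gt0.
rewrite ltr_pdivlMr // => ud Cx x_max; rewrite ltNge; apply/negP => ex.
have Kx : K x by [].
have := x_max _ Cx0; have := psix1 _ (mem_set Kx).
have := ler_norm_dotp (u - u0) (x - x0).
have := ler_norm (- dotp (u - u0) (x - x0)); rewrite normrN.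
have xb : `|x - x0| <= b + b.
  by apply: le_trans (ler_normB _ _) _; rewrite lerD ?Cb'.
have : J%:R * (`|u - u0| * `|x - x0|) <= J%:R * (`|u - u0| * (b + b)).
  by rewrite ler_wpM2l // ler_wpM2l.
have := normr_ge0 (u - u0).
rewrite dotpBl !dotpBr /psi in ud *; lra.
Qed.

(** As a function of z, D(z, y) differs from f z - <gradient f y, z> by a constant, so y matters
    only through its gradient. *)
Lemma left_farthestP {R : realType} {J : nat} (f : 'rV[R]_J -> \bar R)
    (C : set 'rV[R]_J) (y x : 'rV[R]_J) :
  proper_efun f -> C `<=` edom f -> int_edom f y ->
  left_farthest f C y x <-> C x /\ forall z, C z ->
    fine (f z) - dotp (gradient f y) z <= fine (f x) - dotp (gradient f y) x.
Proof.
move=> f_proper Cf fy.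
have bregE z : C z -> bregman f z y = (fine (f z) - fine (f y)
    - dotp (gradient f y) (z - y))%:E.
  move=> /Cf fz; rewrite /bregman mem_set // -(edom_fineK f_proper fz).
  by rewrite -(edom_fineK f_proper (int_edom_sub fy)) -!EFinB.
by split=> -[Cx x_max]; split=> // z Cz; have := x_max z Cz;
  rewrite !bregE // lee_fin !dotpBr; lra.
Qed.

(** * Minimization over the dual variable u *)

Theorem theorem4p4 (R : realType) (J : nat) (f : 'rV[R]_J -> \bar R)
    (C : set 'rV[R]_J)
    (f_legendre : convex_legendre f)
    (f_coercive : one_coercive f)
    (C_nonempty : C !=set0)
    (C_bounded : bounded_set C)
    (C_closed : closed C)
    (C_subset : C `<=` int_edom f)
    (C_klee : left_klee f C) :
  exists x, C = [set x].
Proof.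
have f_proper := legendre_proper f_legendre.
have C_edom : C `<=` edom f by move=> x /C_subset/int_edom_sub.
have /choice[Y YP] : forall u, exists y, int_edom f y /\ gradient f y = u.
  move=> u.
  by have [y] := legendre_gradient_surj f_legendre u f_coercive; exists y.
have /choice[X XP] : forall u, exists x, left_farthest f C (Y u) = [set x].
  by move=> u; exact: C_klee (YP u).1.
have farP u x : left_farthest f C (Y u) x <-> C x /\
    forall z, C z -> fine (f z) - dotp u z <= fine (f x) - dotp u x.
  have := left_farthestP x f_proper C_edom (YP u).1.
  by rewrite (YP u).2.
have XE u : left_farthest f C (Y u) (X u) by rewrite XP.
have CX u : C (X u) by have /farP[] := XE u.
have X_max u z : C z -> fine (f z) - dotp u z <= fine (f (X u)) - dotp u (X u).
  by have /farP[_] := XE u; exact.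
have X_uniq u x : C x -> x != X u ->
    fine (f x) - dotp u x < fine (f (X u)) - dotp u (X u).
  move=> Cx xX; rewrite ltNge; apply: contra_neqN xX => Xx.
  suff : left_farthest f C (Y u) x by rewrite XP.
  by apply/farP; split=> // z /X_max /le_trans; exact.
have Y_ineq u x : edom f x -> fine (f (Y u)) + dotp u (x - Y u) <= fine (f x).
  move=> fx; have := legendre_gradient_ineq f_legendre (YP u).1 fx.
  by rewrite (YP u).2.
(* The first difference is the conjugate of f at u, attained at [Y u] by [Y_ineq]. *)
pose F u := dotp u (Y u) - fine (f (Y u)) + (fine (f (X u)) - dotp u (X u)).
(* Each of the two maxima at v is at least its objective at the maximizer for u. *)
have F_sub u v : F u + dotp (Y u - X u) (v - u) <= F v.
  have := Y_ineq v _ (int_edom_sub (YP u).1); have := X_max v _ (CX u).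
  rewrite /F !dotpBl !dotpBr ![dotp (Y u) _]dotpC ![dotp (X u) _]dotpC; lra.
have F_lsc : lower_semicontinuous (EFin \o F).
  move=> u a; rewrite /= lte_fin => aF.
  (* Here the affine minorant from [F_sub], exact at u, exceeds a. *)
  exists [set v | dotp (Y u - X u) u - (F u - a) < dotp (Y u - X u) v].
    apply: (cvgr_gt _ (@continuous_dotpr _ _ (Y u - X u) u)); lra.
  by move=> v /=; have := F_sub u v; rewrite lte_fin dotpBr; lra.
have [x1 Cx1] := C_nonempty.
have [e [M [e0 eM]]] := legendre_bounded_above f_legendre (C_subset _ Cx1).
(* Test the first maximum with z and the second with x1; their sum contains <u, z - x1>. *)
have F_coercive u : e * (enorm u - 1) - M + fine (f x1) <= F u.
  have [z [fz zM ez]] := eM u.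
  have := Y_ineq u _ fz; have := X_max u _ Cx1.
  rewrite /F !dotpBr in ez *; lra.
have [u0 u0_min] : exists u0, forall u, F u0 <= F u.
  have [|u0 u0_min] := lsc_coercive_min (x0 := 0)
    (r := (F 0 + M - fine (f x1)) / e + 1) F_lsc.
    move=> u; rewrite -ltrBrDr ltr_pdivrMr // => uF; rewrite lee_fin.
    apply: le_trans (F_coercive u); have := ler_norm_enorm u.
    rewrite -(ler_pM2l e0); lra.
  by exists u0.
pose d := X u0 - Y u0.
have XY : X u0 = Y u0.
  apply/eqP; rewrite -subr_eq0; apply/negPn/negP => /dotp_gt0.
  rewrite -/d => dd0.
  have Jd0 : 0 < J%:R * `|d| + 1 by rewrite ltr_wpDl // mulr_ge0.
  (* Displacements of [X] and [Y] below eta contribute at most 2 J |d| eta to the product with d,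
     which is less than <d, d> = 2 eta (J |d| + 1). *)
  pose eta := dotp d d / (J%:R * `|d| + 1) / 2.
  have eta0 : 0 < eta by rewrite !divr_gt0.
  have [dX dX0 X_near] := unique_argmax_continuous (phi := fine \o f)
    C_bounded C_closed
    (fun x Cx => legendre_continuous f_legendre (C_subset _ (set_mem Cx)))
    (CX u0) (X_uniq u0) eta0.
  have [dY dY0 Y_near] :=
    legendre_gradient_inverse_continuous f_legendre (YP u0).1 eta0.
  (* A step along d, a descent direction as - d is a subgradient at u0, short enough for both
     continuity estimates. *)
  pose t := Num.min dX dY / (`|d| + 1) / 2.
  have m0 : 0 < Num.min dX dY by rewrite lt_min dX0.
  have d1 : 0 < `|d| + 1 by rewrite ltr_wpDl.
  have t0 : 0 < t by rewrite !divr_gt0.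
  have tm : `|u0 + t *: d - u0| < Num.min dX dY.
    rewrite addrC addKr normrZ gtr0_norm // /t.
    have -> : Num.min dX dY / (`|d| + 1) / 2 * `|d| =
      Num.min dX dY * (`|d| / (`|d| + 1) / 2) by ring.
    rewrite gtr_pMr // ltr_pdivrMr // ltr_pdivrMr //; have := normr_ge0 d; lra.
  set u := u0 + t *: d in tm.
  move: tm; rewrite lt_min => /andP[uX uY].
  have {}X_near := X_near _ _ uX (CX u) (X_max u).
  have {}Y_near : `|Y u - Y u0| < eta.
    by apply: Y_near (YP u).1 _; rewrite !(YP _).2.
  (* Minimality of u0 against u gives <Y u - X u, d> >= 0, whereas
     Y u - X u is close to - d. *)
  have := F_sub u u0; have := u0_min u.
  have -> : u0 - u = (- t) *: d by apply/rowP => i; rewrite /u !mxE; ring.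
  have -> : Y u - X u = (Y u - Y u0) - (X u - X u0) - d.
    by apply/rowP => i; rewrite /d !mxE; ring.
  rewrite dotpZr dotpBl dotpBl => Fu Fu0.
  have : dotp d d <= dotp (Y u - Y u0) d - dotp (X u - X u0) d.
    by rewrite -(ler_pM2l t0); lra.
  apply/negP; rewrite -ltNge.
  have dE : dotp d d = eta * (J%:R * `|d| + 1) * 2.
    by rewrite /eta mulrAC !divfK ?gt_eqF.
  have bound w : `|w| < eta -> `|dotp w d| <= J%:R * `|d| * eta.
    move=> we; apply: le_trans (ler_norm_dotp _ _) _.
    by rewrite mulrAC mulrA ler_wpM2r // ler_wpM2l // ltW.
  have := bound _ X_near; have := bound _ Y_near.
  have := ler_norm (dotp (Y u - Y u0) d).
  have := ler_norm (- dotp (X u - X u0) d).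
  rewrite normrN dE; lra.
exists (X u0); apply/seteqP; split=> [x Cx|_ ->]; last exact: CX.
apply/eqP/negPn/negP => xX.
have := X_max u0 _ Cx.
have := legendre_gradient_ineq_strict f_legendre (YP u0).1 (C_subset _ Cx).
rewrite (YP u0).2 -XY => /(_ xX); rewrite dotpBr; lra.
Qed.
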